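(* Let $k$ be a field, let $f: X \dashrightarrow Y$ be a rational map of affine varieties over $k$, and let $C$ be a Zariski-closed subset of $X$. Then the set-theoretic image $f(C) \subseteq Y$ admits a relative boundary hull $D$.
   Context: Affine varieties over $k$ are Zariski-closed subsets $X \subseteq \mathbb{A}_k^n$, $Y\subseteq \mathbb{A}_k^m$, taken with their reduced structure (not necessarily irreducible); the underlying topological spaces are the prime spectra of their coordinate rings with the Zariski topology, and $k$ is not assumed to be algebraically closed. A rational map $f$ is given in coordinates by rational functions $b_i = f_i = p_i/q_i$, $i=1,\ldots,m$; for a subset $C \subseteq X$, $f(C)$ denotes the set of images of the points of $C$ at which $f$ is defined (set-theoretic image). Relative boundary hull: let $Y$ be a topological space and $A \subseteq Y$ a nonempty subset with closure $\overline{A}$. A closed set $D \subseteq Y$ is called a relative boundary hull of $A$ if $\overline{A} \setminus A \subseteq D \subsetneq \overline{A}$. The empty set is defined to be the relative boundary hull of itself. *)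

(* Defs.v *)
From HB Require Import structures.
From mathcomp Require Import all_boot all_algebra.
From mathcomp Require Import generic_quotient ring_quotient fraction.
From mathcomp Require Import boolp classical_sets topology.
From mathcomp Require Import mpoly.

Set Implicit Arguments.
Unset Strict Implicit.
Unset Printing Implicit Defensive.

Import GRing.Theory.
Local Open Scope classical_set_scope.
Local Open Scope ring_scope.
Local Open Scope quotient_scope.

(* `A `<` B` is proper inclusion; the empty set is by convention the only
   relative boundary hull of the empty set. *)
Definition relative_boundary_hull (T : topologicalType) (A D : set T) : Prop :=
  (A = set0 -> D = set0) /\
  (A !=set0 -> [/\ closed D, closure A `\` A `<=` D & D `<` closure A]).

(* Points are the bundled prime ideals of the library, which are proper. *)
Definition spec (R : comNzRingType) : Type := prime_idealr R.

HB.instance Definition _ (R : comNzRingType) := gen_eqMixin (spec R).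
HB.instance Definition _ (R : comNzRingType) := gen_choiceMixin (spec R).

Section Zariski.
Variable R : comNzRingType.

Definition in_point (P : spec R) : {pred R} := (P : prime_idealr R).

Definition zero_locus (S : set R) : set (spec R) :=
  [set P | forall g, S g -> g \in in_point P].

Definition zariski_open : set_system (spec R) :=
  [set U | exists S : set R, U = ~` zero_locus S].

Lemma zariski_openT : zariski_open setT.
Proof.
exists setT; rewrite -[LHS]setC0; congr (~` _).
rewrite predeqE => P; split=> // /(_ 1 I).
by rewrite /in_point idealr1.
Qed.

Lemma zariski_openI : setI_closed zariski_open.
Proof.
move=> _ _ [S ->] [T ->].
exists [set g | exists s t, [/\ S s, T t & g = s * t]].
rewrite -setCU; congr (~` _); rewrite predeqE => P; split.
  move=> [hS|hT] _ [s [t [Ss Tt ->]]]; rewrite /in_point prime_idealrM.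
    by apply/orP; left; exact: hS.
  by apply/orP; right; exact: hT.
move=> hST; apply: contrapT => /not_orP[/existsNP[s /not_implyP[Ss sP]]].
move=> /existsNP[t /not_implyP[Tt tP]].
have : s * t \in in_point P by apply: hST; exists s, t.
by rewrite /in_point prime_idealrM => /orP[].
Qed.

Lemma zariski_open_bigU (I : Type) (U : I -> set (spec R)) :
  (forall i, zariski_open (U i)) -> zariski_open (\bigcup_i U i).
Proof.
move=> /choice[S US]; exists (\bigcup_i S i).
rewrite -[LHS]setCK setC_bigcup; congr (~` _); rewrite predeqE => P; split.
  by move=> h g [i _ Sg]; have := h i Logic.I; rewrite US setCK; apply.
by move=> h i _; rewrite US setCK => g Sg; apply: h; exists i.
Qed.

HB.instance Definition _ := isOpenTopological.Build (spec R)
  zariski_openT zariski_openI zariski_open_bigU.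

Lemma zariski_closedE (Z : set (spec R)) :
  closed Z <-> exists S, Z = zero_locus S.
Proof.
split=> [/closed_openC|[S ->]]; last by rewrite -openC; exists S.
by rewrite /open /= => -[S ZS]; exists S; rewrite -[LHS]setCK ZS setCK.
Qed.

Lemma spec_ext (P Q : spec R) : in_point P =i in_point Q -> P = Q.
Proof.
case: P Q => [S cS] [T cT] PQ.
have eST : S = T by apply/funext => g; exact: PQ.
subst T; congr (PrimeIdealr.Pack _).
case: cS cT {PQ} => [[a] [b] [c] [d]] [[a'] [b'] [c'] [d']].
by rewrite (Prop_irrelevance a a') (Prop_irrelevance b b')
  (Prop_irrelevance c c') (Prop_irrelevance d d').
Qed.

End Zariski.

Section ResidueField.
Variables (R : comNzRingType) (P : spec R).

Definition residue_domain : Type := {ideal_quot (P : prime_idealr R)}.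

HB.instance Definition _ := GRing.ComNzRing.on residue_domain.

Definition rdom_unit : {pred residue_domain} :=
  fun x => `[< exists y, y * x = 1 >].

Definition rdom_inv (x : residue_domain) : residue_domain :=
  if pselect (exists y, y * x = 1) is left e then projT1 (cid e) else x.

Lemma rdom_mulVx : {in rdom_unit, left_inverse 1 rdom_inv *%R}.
Proof.
move=> x /asboolP ux; rewrite /rdom_inv; case: pselect => // e.
by case: cid.
Qed.

Lemma rdom_unitPl (x y : residue_domain) : y * x = 1 -> rdom_unit x.
Proof. by move=> yx1; apply/asboolP; exists y. Qed.

Lemma rdom_inv_out : {in [predC rdom_unit], rdom_inv =1 id}.
Proof.
move=> x /negP ux; rewrite /rdom_inv; case: pselect => // e.
by case: ux; apply/asboolP.
Qed.

HB.instance Definition _ := GRing.ComNzRing_hasMulInverse.Build residue_domain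
  rdom_mulVx rdom_unitPl rdom_inv_out.

HB.instance Definition _ := GRing.ComUnitRing_isIntegral.Build residue_domain
  (@Quotient.rquot_IdomainAxiom R P).

Definition residue_field : fieldType := {fraction residue_domain}.

(* The reduction map from R to R/P to Frac(R/P). *)
Definition residue (g : R) : residue_field :=
  @FracField.tofrac residue_domain (\pi_{ideal_quot (P : prime_idealr R)} g).

Lemma residue_zmod_morphism : zmod_morphism residue.
Proof. by move=> x y; rewrite /residue rmorphB -tofracB. Qed.

Lemma residue_monoid_morphism : monoid_morphism residue.
Proof.
by split=> [|x y]; rewrite /residue ?rmorph1 ?tofrac1 // rmorphM -tofracM.
Qed.

HB.instance Definition _ :=
  GRing.isZmodMorphism.Build R residue_field residue residue_zmod_morphism.
HB.instance Definition _ :=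
  GRing.isMonoidMorphism.Build R residue_field residue residue_monoid_morphism.

Lemma residue_eq0 g : (residue g == 0) = (g \in in_point P).
Proof.
rewrite /residue (tofrac_eq0 (R := residue_domain)).
have -> : (0 : residue_domain) = \pi_{ideal_quot (P : prime_idealr R)} 0.
  by rewrite rmorph0.
by rewrite -Quotient.idealrBE subr0.
Qed.

End ResidueField.

Section KernelPoint.
Variables (R : comNzRingType) (K : fieldType) (phi : {rmorphism R -> K}).

Definition kernel_pred : R -> bool := fun g => phi g == 0.

Lemma kernel_idealr_closed : idealr_closed kernel_pred.
Proof.
split; rewrite /kernel_pred ?unfold_in ?rmorph0 ?rmorph1 ?eqxx ?oner_neq0 //.
move=> a u v; rewrite !unfold_in => /eqP u0 /eqP v0.
by rewrite rmorphD rmorphM u0 v0 mulr0 addr0.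
Qed.

Lemma kernel_prime : prime_idealr_closed kernel_pred.
Proof. by move=> u v; rewrite !unfold_in rmorphM mulf_eq0. Qed.

HB.instance Definition _ := isIdealr.Build R kernel_pred kernel_idealr_closed.
HB.instance Definition _ :=
  isPrimeIdealrClosed.Build R kernel_pred kernel_prime.

Definition kernel_point : spec R := kernel_pred : prime_idealr R.

End KernelPoint.

(* Spec k[x_1, .., x_n]. For a closed X in it, the type set_type X to which X
   coerces carries the subspace topology, and stands for Spec k[X]: the primes
   of k[X] are the primes of k[x_1, .., x_n] containing I(X). *)
Definition affine_space (k : fieldType) (n : nat) : topologicalType :=
  spec {mpoly k[n]}.

(* The image in affine m-space of the K-valued point with coordinates v, where
   K is a k-algebra through phi: the kernel of the evaluation at v. *)
Definition point_of_coords (k : fieldType) (m : nat) (K : fieldType)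
    (phi : {rmorphism k -> K}) (v : 'I_m -> K) : affine_space k m :=
  kernel_point (mmap phi v : {rmorphism {mpoly k[m]} -> K}).

Section RationalMaps.
Variables (k : fieldType) (n : nat).
Local Notation poly_n := {mpoly k[n]}.
Implicit Type X : set (affine_space k n).

Definition vanishing_ideal X : set poly_n :=
  [set g | forall P, X P -> g \in in_point P].

(* Rational functions are elements of the total ring of fractions of
   k[X] = k[x_1, .., x_n] / I(X), since X may be reducible; they are given by
   fractions whose denominator is not a zero divisor in k[X], up to ratfun_eq. *)
Record ratfun X := RatFun {
  num : poly_n;
  den : poly_n;
  den_regular : forall g, vanishing_ideal X (g * den) -> vanishing_ideal X g }.

Definition ratfun_eq X (r s : ratfun X) : Prop :=
  vanishing_ideal X (num r * den s - num s * den r).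

(* r is defined at x with value c in the residue field of x. Being defined at x
   is a property of the rational function, not of the fraction giving it: some
   equal fraction has a denominator that does not vanish at x. *)
Definition ratfun_value X (r : ratfun X) (x : X) (c : residue_field (\val x)) :
    Prop :=
  exists s : ratfun X, [/\ ratfun_eq r s, den s \notin in_point (\val x) &
    c = residue (\val x) (num s) / residue (\val x) (den s)].

Definition scalar_residue (P : affine_space k n) :
    {rmorphism k -> residue_field P} :=
  residue P \o @mpolyC n k.

(* Q is the image of x under the map with coordinates f; there is such a Q
   exactly when all the f i are defined at x, and then it is unique. *)
Definition coords_image X m (f : 'I_m -> ratfun X) (x : X)
    (Q : affine_space k m) : Prop :=
  exists2 v : 'I_m -> residue_field (\val x),
    forall i, ratfun_value (f i) (v i) &
    Q = point_of_coords (scalar_residue (\val x)) v.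

Record rational_map m X (Y : set (affine_space k m)) := RationalMap {
  coords : 'I_m -> ratfun X;
  coords_into : forall x Q, coords_image coords x Q -> Y Q }.

Definition image_of m X (Y : set (affine_space k m)) (f : rational_map X Y)
    (C : set X) : set Y :=
  [set y | exists2 x, C x & coords_image (coords f) x (\val y)].

End RationalMaps.

(* Main.v *)
Require Import Defs.
From HB Require Import structures.
From mathcomp Require Import all_boot all_order all_algebra fieldext.
From mathcomp Require Import fraction ring_quotient.
From mathcomp Require Import boolp classical_sets topology mpoly.

(* It suffices that f(C) contains a nonempty open subset of its closure. The
   part of C where f is defined has finitely many generic points, and f(C)
   lies in the closure of their images. Let x be one of them whose image Q is
   minimal; some g1 outside Q lies in every other such image not above Q. As
   in Chevalley's theorem, there is g2 outside Q such that every prime above Q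
   avoiding g2 is the image of a specialization of x: the coordinate ring of
   the source is generated over that of the target by finitely many elements,
   and a field-valued point extends along one generator at a time, to a
   transcendental or to a root of a polynomial of minimal degree. Then D is
   the part of the closure of f(C) where g1 g2 vanishes. *)

Set Implicit Arguments.
Unset Strict Implicit.
Unset Printing Implicit Defensive.

Import Order.TTheory GRing.Theory.
Local Open Scope classical_set_scope.
Local Open Scope ring_scope.

(** * Extending field-valued points along one generator *)

Lemma ex_minimal (T : Type) (f : T -> nat) (S : T -> Prop) :
  (exists x, S x) -> exists2 x, S x & forall y, S y -> (f x <= f y)%N.
Proof.
move=> [x0 Sx0].
have exn : exists n, `[< exists2 x, S x & f x = n >].
  by exists (f x0); apply/asboolP; exists x0.
case: (ex_minnP exn) => _ /asboolP[x Sx <-] min_x; exists x => // y Sy.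
by apply: min_x; apply/asboolP; exists y.
Qed.

(** A nonconstant divisor of minimal size is irreducible, so adjoining one of its roots to [K] gives
    a field in which [p] has a root. *)
Lemma exists_root (K : fieldType) (p : {poly K}) : (1 < size p)%N ->
  exists (K' : fieldType) (iota : {rmorphism K -> K'}) (w : K'),
    root (map_poly iota p) w.
Proof.
move=> sp; have [//|q] := @ex_minimal {poly K} (fun q => size q)
  (fun q => (1 < size q)%N /\ q %| p); first by exists p; rewrite dvdpp.
move=> [sq qp] min_q.
have irr_q : irreducible_poly q.
  split=> // d d1 dq; rewrite -dvdp_size_eqp // eqn_leq dvdp_leq //; last first.
    by rewrite -size_poly_gt0 ltnW.
  apply: min_q; split; last exact: dvdp_trans qp.
  rewrite ltn_neqAle eq_sym d1 size_poly_gt0; apply/eqP => d0.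
  by move: dq sq; rewrite d0 dvd0p => /eqP ->; rewrite size_poly0.
have [L _ [w rw _]] := irredp_FAdjoin irr_q.
exists L, (in_alg L), w; rewrite -(divpK qp) rmorphM /= rootM.
by rewrite rw orbT.
Qed.

Section OneVariable.
Variables (A : comNzRingType) (L : fieldType) (phi : {rmorphism A -> L}) (z : L).
Local Notation ev p := (map_poly phi p).[z].

(* phi need not be injective: a leading coefficient may map to 0. *)
Lemma trim_map_poly (p : {poly A}) : map_poly phi p != 0 ->
  exists2 q : {poly A}, map_poly phi q = map_poly phi p & phi (lead_coef q) != 0.
Proof.
move=> p0; set n := size (map_poly phi p).
have eq_map : map_poly phi (\poly_(i < n) p`_i) = map_poly phi p.
  apply/polyP => i; rewrite !coef_map coef_poly; case: ltnP => // ni.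
  by rewrite raddf0 -coef_map nth_default.
exists (\poly_(i < n) p`_i) => //.
have n0 : (0 < n)%N by rewrite size_poly_gt0.
have pn : p`_n.-1 != 0.
  apply: contra_neq p0 => pn.
  by apply/eqP; rewrite -lead_coef_eq0 lead_coefE coef_map -/n pn raddf0.
rewrite lead_coef_poly // -coef_map.
by rewrite -lead_coefE lead_coef_eq0.
Qed.

Lemma size_map_trimmed (p : {poly A}) :
  phi (lead_coef p) != 0 -> size (map_poly phi p) = size p.
Proof. exact: size_map_poly_id0. Qed.

(** When [z] is transcendental over the image of [phi], it can be sent to the indeterminate of the
    rational function field over [K]. The element [a] is the coefficient of [b] that becomes leading
    under [phi]; if it survives under [psi], so does [b]. *)
Lemma extend_transcendental (b : {poly A}) :
    (forall p, ev p = 0 -> map_poly phi p = 0) -> ev b != 0 ->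
  exists2 a, phi a != 0 & forall (K : fieldType) (psi : {rmorphism A -> K}),
    (forall c, phi c = 0 -> psi c = 0) -> psi a != 0 ->
    exists (K' : fieldType) (iota : {rmorphism K -> K'}) (w : K'),
      (forall p, ev p = 0 -> (map_poly (iota \o psi) p).[w] = 0) /\
      (map_poly (iota \o psi) b).[w] != 0.
Proof.
move=> trans evb.
have : map_poly phi b != 0 by apply: contra_neq evb => ->; rewrite horner0.
rewrite -lead_coef_eq0 lead_coefE coef_map; set i := _.-1 => bi0.
exists b`_i => // K psi ker_psi psi_b.
have evE p :
    (map_poly ((@FracField.tofrac {poly K} \o polyC) \o psi) p).[FracField.tofrac 'X]
    = FracField.tofrac (map_poly psi p).
  rewrite map_poly_comp map_poly_comp horner_map /=.
  by rewrite -/(comp_poly 'X (map_poly psi p)) comp_polyXr.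
exists {fraction {poly K}}, (@FracField.tofrac {poly K} \o polyC),
  (FracField.tofrac 'X).
split=> [p /trans p0|]; rewrite evE ?tofrac_eq0.
  apply/eqP; rewrite tofrac_eq0; apply/eqP/polyP => j; rewrite coef0 coef_map.
  by apply: ker_psi; rewrite -coef_map p0 coef0.
by apply: contra_neq psi_b => b0; rewrite -coef_map b0 coef0.
Qed.

Section Algebraic.
(** Up to a scalar, the image of [p] is the minimal polynomial of [z] over the fraction field of the
    image of [phi]. It is kept with coefficients in [A] so that [psi] can be applied to it. *)
Variable p : {poly A}.
Hypotheses (lead_p : phi (lead_coef p) != 0) (ev_p : ev p = 0).
Hypothesis min_p : forall q, ev q = 0 -> map_poly phi q != 0 ->
  (size p <= size (map_poly phi q))%N.

Let p_neq0 : p != 0.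
Proof. by apply: contra_neq lead_p => ->; rewrite lead_coef0 rmorph0. Qed.

Lemma minimal_size_gt1 : (1 < size p)%N.
Proof.
rewrite ltnNge; apply/negP => /size1_polyC p0; move: lead_p ev_p.
by rewrite p0 lead_coefC map_polyC hornerC /= => /eqP.
Qed.

(** Pseudo-divide [h] by [p]. The remainder vanishes at [z] and is shorter than [p], so its
    coefficients lie in the kernel of [phi], hence in that of [psi]; evaluating at [w] leaves a
    power of the leading coefficient times the value of [h]. *)
Lemma minimal_kernel (K : fieldType) (psi : {rmorphism A -> K}) (w : K) :
    (forall c, phi c = 0 -> psi c = 0) -> psi (lead_coef p) != 0 ->
    root (map_poly psi p) w ->
  forall h, ev h = 0 -> (map_poly psi h).[w] = 0.
Proof.
move=> ker_psi lead_psi /eqP rw h ev_h.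
have := Pdiv.ComRing.rdivp_eq p h.
set N := Pdiv.Ring.rscalp h p; set q := Pdiv.Ring.rdivp h p.
set r := Pdiv.Ring.rmodp h p => div_h.
have sr : (size r < size p)%N by rewrite Pdiv.Ring.ltn_rmodpN0.
have r0 : map_poly phi r = 0.
  apply: contraTeq sr => r0; rewrite -leqNgt.
  apply: leq_trans (size_poly _ _); apply: min_p => //.
  have := congr1 (fun f => ev f) div_h.
  rewrite /= rmorphD rmorphM /= map_polyZ hornerD hornerM hornerZ ev_h ev_p.
  by rewrite !mulr0 add0r.
have r0' : map_poly psi r = 0.
  apply/polyP => j; rewrite coef0 coef_map; apply: ker_psi.
  by rewrite -coef_map r0 coef0.
have := congr1 (fun f => (map_poly psi f).[w]) div_h.
rewrite /= rmorphD rmorphM /= map_polyZ r0' addr0 hornerM hornerZ rw mulr0.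
by move=> /eqP; rewrite mulf_eq0 rmorphXn expf_eq0 (negPf lead_psi) andbF => /eqP.
Qed.

Lemma minimal_inverse (b : {poly A}) : ev b != 0 ->
  exists a v, phi a != 0 /\ ev (a%:P - v * b) = 0.
Proof.
move=> evb.
(* An element r of minimal size in the ideal (p, b), modulo the kernel of
   evaluation, is constant: otherwise pseudo-dividing p by r contradicts the
   minimality of r or of p. *)
have [|r0 [evr0 [v0 r0v]] min_r] := @ex_minimal {poly A}
  (fun r => size (map_poly phi r))
  (fun r => ev r != 0 /\ exists v, ev r = ev v * ev b).
  by exists b; split=> //; exists 1; rewrite rmorph1 hornerC mul1r.
have r0n0 : map_poly phi r0 != 0.
  by apply: contra_neq evr0 => ->; rewrite horner0.
have [r er lead_r] := trim_map_poly r0n0.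
rewrite -er in r0v evr0 min_r; have {r0n0} rn0 : r != 0.
  by apply: contra_neq lead_r => ->; rewrite lead_coef0 rmorph0.
rewrite (size_map_trimmed lead_r) in min_r.
have [r1|r1] := leqP (size r) 1.
  exists (lead_coef r), v0; split=> //.
  move: (size1_polyC r1) r0v => ->; rewrite lead_coefC => r0v.
  by rewrite rmorphB rmorphM hornerD hornerN hornerM r0v subrr.
have rp : (size r < size p)%N.
  have := Pdiv.ComRing.rdivp_eq p r.
  set N := Pdiv.Ring.rscalp r p; set q := Pdiv.Ring.rdivp r p.
  set s := Pdiv.Ring.rmodp r p => div_r.
  have sr : (size s < size p)%N by rewrite Pdiv.Ring.ltn_rmodpN0.
  have evs : ev s = phi (lead_coef p ^+ N) * ev r.
    rewrite -hornerZ -map_polyZ div_r rmorphD rmorphM hornerD hornerM ev_p.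
    by rewrite mulr0 add0r.
  apply: leq_ltn_trans sr; apply: leq_trans (size_poly _ _); apply: min_r.
  split; first by rewrite evs mulf_neq0 // rmorphXn expf_neq0.
  exists ((lead_coef p ^+ N)%:P * v0).
  by rewrite evs r0v rmorphM /= hornerM map_polyC hornerC mulrA.
exfalso.
have := Pdiv.ComRing.rdivp_eq r p.
set N := Pdiv.Ring.rscalp p r; set q := Pdiv.Ring.rdivp p r.
set s := Pdiv.Ring.rmodp p r => div_p.
have sr : (size s < size r)%N by rewrite Pdiv.Ring.ltn_rmodpN0.
have evs : ev s = - ev q * ev r.
  have := congr1 (fun f => ev f) div_p.
  rewrite /= rmorphD rmorphM /= map_polyZ hornerD hornerM hornerZ ev_p mulr0.
  by move=> /esym/eqP; rewrite addrC addr_eq0 mulNr => /eqP.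
have lN : phi (lead_coef r ^+ N) != 0 by rewrite rmorphXn expf_neq0.
have mapE : phi (lead_coef r ^+ N) *: map_poly phi p - map_poly phi s
    = map_poly phi q * map_poly phi r.
  by rewrite -map_polyZ div_p rmorphD rmorphM addrK.
have sE : size (map_poly phi q * map_poly phi r) = size p.
  rewrite -mapE size_polyDl size_scale // size_map_trimmed // size_polyN.
  by apply: leq_ltn_trans (size_poly _ _) (ltn_trans sr rp).
have qn0 : map_poly phi q != 0.
  apply: contraTneq minimal_size_gt1 => q0.
  by rewrite -sE q0 mul0r size_poly0.
(* Since [r] is not constant, [q] is shorter than [p] and so does not vanish at [z]; then neither
   does [s], which thus competes with [r]. *)
have sq : (size (map_poly phi q) < size p)%N.
  rewrite -sE size_mul //; last first.
    by rewrite -size_poly_gt0 size_map_trimmed ?size_poly_gt0.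
  rewrite (size_map_trimmed lead_r).
  by case: (size r) r1 => [|[|l]] // _; rewrite !addnS ltnS leq_addr.
have evq : ev q != 0.
  by apply: contraTneq sq => evq; rewrite -leqNgt min_p.
have : (size r <= size (map_poly phi s))%N.
  apply: min_r; split; first by rewrite evs mulf_neq0 ?oppr_eq0.
  exists (- q * v0); rewrite evs r0v rmorphM rmorphN /= hornerM hornerN.
  by rewrite mulrA.
by rewrite leqNgt (leq_ltn_trans (size_poly _ _) sr).
Qed.

End Algebraic.

(** The value of [z] becomes an indeterminate if [z] is transcendental over the image of [phi], and
    otherwise a root of the image under [psi] of a minimal polynomial. *)
Lemma extend_one (b : {poly A}) : ev b != 0 ->
  exists2 a, phi a != 0 & forall (K : fieldType) (psi : {rmorphism A -> K}),
    (forall c, phi c = 0 -> psi c = 0) -> psi a != 0 ->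
    exists (K' : fieldType) (iota : {rmorphism K -> K'}) (w : K'),
      (forall p, ev p = 0 -> (map_poly (iota \o psi) p).[w] = 0) /\
      (map_poly (iota \o psi) b).[w] != 0.
Proof.
move=> evb.
have [trans|] := pselect (forall p, ev p = 0 -> map_poly phi p = 0).
  exact: extend_transcendental.
move=> /existsNP[p1 /not_implyP[evp1 /eqP p1n0]].
have [|p0 [evp0 p0n0] min_p0] := @ex_minimal {poly A}
  (fun p => size (map_poly phi p)) (fun p => ev p = 0 /\ map_poly phi p != 0).
  by exists p1.
have [p ep lead_p] := trim_map_poly p0n0.
rewrite -ep in evp0 min_p0.
have min_p q : ev q = 0 -> map_poly phi q != 0 ->
    (size p <= size (map_poly phi q))%N.
  by move=> q0 qn0; rewrite -(size_map_trimmed lead_p); apply: min_p0.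
have [a0 [v [a0n0 eva0]]] := minimal_inverse lead_p evp0 min_p evb.
(* The first factor keeps the degree of [p] under [psi], which yields the root [w] and allows the
   pseudo-division; the second is a multiple of [b] modulo relations at [z], which keeps [b] nonzero
   at [w]. *)
exists (lead_coef p * a0) => [|K psi ker_psi].
  by rewrite rmorphM mulf_neq0.
rewrite rmorphM mulf_eq0 => /norP[lead_psi psi_a0].
have [|K' [iota [w rw]]] := @exists_root _ (map_poly psi p).
  by rewrite size_map_poly_id0 // (minimal_size_gt1 lead_p).
have ker h : ev h = 0 -> (map_poly (iota \o psi) h).[w] = 0.
  apply: (minimal_kernel lead_p evp0 min_p) => [c /ker_psi /= ->||].
  - by rewrite rmorph0.
  - by rewrite fmorph_eq0.
  - by rewrite map_poly_comp.
exists K', iota, w; split=> //.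
have /eqP := ker _ eva0; rewrite rmorphB rmorphM /= map_polyC hornerD hornerN.
rewrite hornerC hornerM subr_eq0 => /eqP e; apply/eqP => b0; move: psi_a0.
by rewrite -(fmorph_eq0 iota) -[iota _]/((iota \o psi) a0) e b0 mulr0 eqxx.
Qed.

End OneVariable.

(** * Extending field-valued points along several generators *)

Lemma horner_muni (k K : comNzRingType) (n : nat)
    (g : {rmorphism {mpoly k[n]} -> K}) (h : {rmorphism k -> K})
    (v : 'I_n.+1 -> K) (p : {mpoly k[n.+1]}) :
    (forall c, g c%:MP = h c) ->
    (forall i, g 'X_i = v (widen_ord (leqnSn n) i)) ->
  (map_poly g (muni p)).[v ord_max] = mmap h v p.
Proof.
move=> gC gX; rewrite muniE rmorph_sum horner_sum /mmap; apply: eq_bigr => m _.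
rewrite /= map_polyZ hornerZ map_polyXn hornerXn.
rewrite -mul_mpolyC rmorphM /= gC -mulrA; congr (_ * _).
rewrite /mmap1 big_ord_recr mpolyXE_id rmorph_prod /=; congr (_ * _).
by apply: eq_bigr => i _; rewrite rmorphXn /= gX mnmE.
Qed.

Section ExtendPoints.
(** Coordinates are indexed by [nat], so that a point restricts to its first coordinates without
    casts between ordinals. *)
Variables (k L : fieldType) (h : {rmorphism k -> L}) (z : nat -> L).
Local Notation eval h w n := (mmap h (fun i : 'I_n => w (val i))).

(** Induction on [j]: [extend_one], applied to the last variable, turns [b] into a condition [a1] on
    the other variables, to which the induction hypothesis applies. *)
Lemma extend_point (m j : nat) (b : {mpoly k[j + m]}) : eval h z (j + m) b != 0 ->
  exists2 a : {mpoly k[m]}, eval h z m a != 0 &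
    forall (K : fieldType) (h' : {rmorphism k -> K}) (w : nat -> K),
      (forall p : {mpoly k[m]}, eval h z m p = 0 -> eval h' w m p = 0) ->
      eval h' w m a != 0 ->
    exists (K' : fieldType) (iota : {rmorphism K -> K'}) (w' : nat -> K'),
      [/\ forall i, (i < m)%N -> w' i = iota (w i),
        forall p, eval h z (j + m) p = 0 ->
          eval (iota \o h') w' (j + m) p = 0 &
        eval (iota \o h') w' (j + m) b != 0].
Proof.
elim: j => [|j IHj] in b *.
  move=> b0; exists b => // K h' w sp wb; exists K, idfun, w.
  by split.
pose phi := mmap h (fun i : 'I_(j + m) => z i) : {rmorphism _ -> _}.
have phiE (p : {mpoly k[(j + m).+1]}) :
    (map_poly phi (muni p)).[z (j + m)%N] = eval h z (j + m).+1 p.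
  apply: (@horner_muni _ _ _ phi h (fun i : 'I_(j + m).+1 => z i)) => [c|i].
    by rewrite /phi /= mmapC.
  by rewrite /phi /= mmapX mmap1U.
rewrite -phiE => /extend_one[a1 /IHj[a a0 IHa] ext]; exists a => // K h' w sp wa.
have [K1 [iota1 [w1 [w1w sp1 wa1]]]] := IHa K h' w sp wa.
pose psi := mmap (iota1 \o h') (fun i : 'I_(j + m) => w1 i) : {rmorphism _ -> _}.
have [K' [iota [x [spx bx]]]] := ext K1 psi sp1 wa1.
pose w' i := if (i < j + m)%N then iota (w1 i) else x.
have psiE (p : {mpoly k[(j + m).+1]}) :
    (map_poly (iota \o psi) (muni p)).[x] =
    eval ((iota \o iota1) \o h') w' (j + m).+1 p.
  have -> : x = w' (j + m)%N by rewrite /w' ltnn.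
  apply: (@horner_muni _ _ _ (iota \o psi) ((iota \o iota1) \o h')
    (fun i : 'I_(j + m).+1 => w' i)) => [c|i].
    by rewrite /psi /= mmapC.
  by rewrite /psi /= mmapX mmap1U /w' ltn_ord.
exists K', (iota \o iota1), w'; split.
- by move=> i im; rewrite /w' (leq_trans im (leq_addl _ _)) w1w.
- by move=> p; rewrite -phiE -psiE; apply: spx.
- by rewrite -psiE.
Qed.

End ExtendPoints.

(** * Noetherianity of polynomial rings *)

(** Let [c N] be an index from [N] on where [f] is smallest. Iterating [c] past the previous index
    gives the subsequence, as each term minimizes [f] on a tail containing all later terms. *)
Lemma nondecreasing_subsequence (f : nat -> nat) :
  exists2 s : nat -> nat, {homo s : i j / (i < j)%N} &
    {homo f \o s : i j / (i <= j)%N}.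
Proof.
have /choice[c minc] N : exists i, (N <= i)%N /\
    forall j, (N <= j)%N -> (f i <= f j)%N.
  by have [|i Ni min_i] := @ex_minimal nat f (fun i => (N <= i)%N);
    [exists N | exists i].
pose s := fix s i := if i is i'.+1 then c (s i').+1 else c 0%N.
have s_lt i : (s i < s i.+1)%N by have [] := minc (s i).+1.
exists s; first exact: homo_ltn ltn_trans s_lt.
apply: homo_leq => // [|i]; first exact: leq_trans.
have [N sN] : exists N, s i = c N by case: i => [|i]; [exists 0%N | exists (s i).+1].
have [Nc min_c] := minc N; rewrite -sN in Nc min_c; apply: min_c.
exact: leq_trans Nc (ltnW (s_lt i)).
Qed.

(** Subsequences are extracted one coordinate at a time; [c] counts the coordinates already made
    nondecreasing. *)
Lemma dickson (n : nat) (u : nat -> 'X_{1..n}) :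
  exists i j, (i < j)%N /\ (u i <= u j)%MM.
Proof.
suff H c : exists2 s : nat -> nat, {homo s : i j / (i < j)%N} &
    forall i j, (i <= j)%N -> forall l : 'I_n, (l < c)%N ->
      (u (s i) l <= u (s j) l)%N.
  have [s s_lt le_s] := H n; exists (s 0%N), (s 1%N); split; first exact: s_lt.
  by apply/mnm_lepP => l; apply: le_s.
elim: c => [|c [s s_lt le_s]]; first by exists id.
have [cn|nc] := ltnP c n; last first.
  exists s => // i j ij l _; apply: le_s => //.
  exact: leq_trans (ltn_ord l) nc.
have [t t_lt le_t] :=
  nondecreasing_subsequence (fun i => u (s i) (Ordinal cn)).
have t_le : {homo t : i j / (i <= j)%N}. exact: ltnW_homo.
exists (s \o t) => [i j /t_lt/s_lt //|i j ij l].
rewrite ltnS leq_eqVlt => /orP[/eqP lc|lc]; last exact/le_s/lc/t_le.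
by have -> : l = Ordinal cn by [apply: val_inj]; apply: le_t.
Qed.

(** The whole ring is allowed, so that adjoining an element to an ideal always gives an ideal. *)
Definition is_ideal (R : comNzRingType) (I : set R) : Prop :=
  [/\ I 0, forall f g, I f -> I g -> I (f - g) & forall a f, I f -> I (a * f)].

Section Noetherian.
Variables (k : fieldType) (n : nat).
Implicit Types (I J : set {mpoly k[n]}).

Lemma ex_minimal_mlead (S : set {mpoly k[n]}) : S !=set0 ->
  exists2 f, S f & forall g, S g -> ~~ (mlead g < mlead f)%O.
Proof.
move=> [f]; move: {-1}(mlead f) (erefl (mlead f)) => m.
elim/(well_founded_ind (@ltom_wf n)): m f => m IHm f fm Sf.
have [[g Sg gf]|min_f] := pselect (exists2 g, S g & (mlead g < mlead f)%O).
  by apply: (IHm (mlead g) _ g); rewrite // -fm.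
by exists f => // g Sg; apply/negP => gf; apply: min_f; exists g.
Qed.

Lemma no_ideal_chain (I : nat -> set {mpoly k[n]}) :
  (forall i, is_ideal (I i)) -> ~ (forall i, I i `<` I i.+1).
Proof.
move=> idI chain.
have leI i j : (i <= j)%N -> I i `<=` I j.
  apply: (@homo_leq _ I (fun A B => A `<=` B)) => [A//|B A C|l].
  - by move=> AB BC x /AB/BC.
  - by case: (chain l).
(* By minimality, the leading monomial of f i is not that of an element of
   I i, so it is not divisible by any earlier one. *)
have /choice[f minf] i : exists f, (I i.+1 f /\ ~ I i f) /\
    forall g, I i.+1 g -> ~ I i g -> ~~ (mlead g < mlead f)%O.
  have [|f If min_f] := @ex_minimal_mlead (I i.+1 `\` I i).
    by have [_ /existsNP[f /not_implyP[]]] := chain i; exists f.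
  by exists f; split=> // g g1 g0; apply: min_f.
have [i [j [ij le_ij]]] := dickson (fun i => mlead (f i)).
have [[fi1 fi0] _] := minf i; have [[fj1 fj0] min_j] := minf j.
have fn0 l : ~ I l (f l) -> f l != 0.
  by move=> fl; apply: contra_notN fl => /eqP ->; case: (idI l).
have [fin0 fjn0] := (fn0 _ fi0, fn0 _ fj0).
pose c := mleadc (f j) / mleadc (f i).
have cn0 : c != 0 by rewrite mulf_neq0 ?invr_eq0 ?mleadc_eq0.
(* This multiple of [f i] has the leading term of [f j], so [f j - g] has a smaller leading monomial
   while still lying in [I j.+1] and outside [I j]. *)
pose g := c *: ('X_[(mlead (f j) - mlead (f i))%MM] * f i).
have g_lead : mlead g = mlead (f j).
  rewrite mleadZ // mleadM ?mleadXm ?submK //.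
  by rewrite -mleadc_eq0 mleadXm mcoeffX eqxx oner_neq0.
have g_leadc : g@_(mlead (f j)) = mleadc (f j).
  rewrite mcoeffZ -[X in _@_X](submK le_ij) mulrC.
  by rewrite [_ * f i]mulrC mcoeffMX mulrC divfK ?mleadc_eq0.
have Ig : I j g.
  apply: (leI i.+1) => //; rewrite /g -mul_mpolyC mulrA.
  by have [_ _] := idI i.+1; apply.
have Ifg : I j.+1 (f j - g).
  by have [_ IB _] := idI j.+1; apply: IB => //; apply: leI Ig.
have nIfg : ~ I j (f j - g).
  have [I0 IB _] := idI j; move=> Ifg'; apply: fj0.
  have -> : f j = f j - g - (0 - g) by rewrite sub0r opprK subrK.
  exact: (IB _ _ Ifg' (IB _ _ I0 Ig)).
have fgn0 : f j - g != 0.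
  by apply: contra_notN nIfg => /eqP ->; case: (idI j).
have /negP[] := min_j _ Ifg nIfg.
rewrite lt_neqAle; apply/andP; split; last first.
  by have := mleadB_le (f j) g; rewrite g_lead joinxx.
apply: contra fgn0 => /eqP lead_eq.
by rewrite -mleadc_eq0 lead_eq mcoeffB g_leadc subrr.
Qed.

(** Every counterexample would be properly contained in another one, and choice would build an
    infinite ascending chain. *)
Lemma noetherian_ind (P : set {mpoly k[n]} -> Prop) :
    (forall I, is_ideal I -> (forall J, is_ideal J -> I `<` J -> P J) -> P I) ->
  forall I, is_ideal I -> P I.
Proof.
move=> ind I0 idI0; apply: contrapT => nP0.
pose T := {I | is_ideal I /\ ~ P I}.
have /choice[next nextP] (x : T) : exists y : T, sval x `<` sval y.
  case: x => I [idI nPI] /=; apply: contrapT => nJ; apply/nPI/ind => // J idJ IJ.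
  by apply: contrapT => nPJ; apply: nJ; exists (exist _ J (conj idJ nPJ)).
apply: (@no_ideal_chain (fun i => sval (iter i next (exist _ I0 (conj idI0 nP0))))).
  by move=> i; case: (svalP (iter i next (exist _ I0 (conj idI0 nP0)))).
by move=> i; apply: nextP.
Qed.

End Noetherian.

(** * Prime ideals as points, and generic points of closed sets *)

Section PrimePoint.
Variables (R : comNzRingType) (I : set R).
Hypotheses (idI : is_ideal I) (properI : ~ I 1).
Hypothesis primeI : forall f g, I (f * g) -> I f \/ I g.

Definition prime_pred : R -> bool := fun g => `[< I g >].

Lemma prime_pred_idealr_closed : idealr_closed prime_pred.
Proof.
have [I0 IB IM] := idI; split; rewrite ?unfold_in.
- exact/asboolP.
- exact/asboolP.
- move=> a u v; rewrite !unfold_in => /asboolP Iu /asboolP Iv; apply/asboolP.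
  have -> : a * u + v = a * u - (0 - v) by rewrite sub0r opprK.
  exact: (IB _ _ (IM _ _ Iu) (IB _ _ I0 Iv)).
Qed.

Lemma prime_pred_prime : prime_idealr_closed prime_pred.
Proof.
move=> u v; rewrite !unfold_in => /asboolP /primeI[Iu|Iv]; apply/orP.
  by left; apply/asboolP.
by right; apply/asboolP.
Qed.

HB.instance Definition _ := isIdealr.Build R prime_pred prime_pred_idealr_closed.
HB.instance Definition _ :=
  isPrimeIdealrClosed.Build R prime_pred prime_pred_prime.

Definition prime_point : spec R := prime_pred : prime_idealr R.

Lemma in_prime_point g : (g \in in_point prime_point) = `[< I g >].
Proof. by []. Qed.

End PrimePoint.

(** The set is the sum of [I] and the principal ideal of [u]. *)
Lemma is_ideal_adjoin (R : comNzRingType) (I : set R) (u : R) :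
  is_ideal I -> is_ideal [set f | exists a, I (f - a * u)].
Proof.
move=> [I0 IB IM]; split.
- by exists 0; rewrite mul0r subr0.
- move=> f g [a fa] [b gb]; exists (a - b).
  have -> : f - g - (a - b) * u = (f - a * u) - (g - b * u)
    by rewrite mulrBl !opprB addrACA [RHS]addrACA [- g + _]addrC.
  exact: IB.
- by move=> c f [a fa]; exists (c * a); rewrite -mulrA -mulrBr; apply: IM.
Qed.

(** Noetherian induction: if [u * v] is in [I] but [u] and [v] are not, each prime above [I]
    contains [u] or [v], so the lists for the two larger ideals can be concatenated. The list may be
    redundant. *)
Lemma finite_generic_points (k : fieldType) (n : nat) (I : set {mpoly k[n]}) :
    is_ideal I ->
  exists s : seq (spec {mpoly k[n]}),
    (forall P, P \in s -> zero_locus I P) /\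
    forall Q, zero_locus I Q ->
      exists2 P, P \in s & {subset in_point P <= in_point Q}.
Proof.
move: I; apply: noetherian_ind => I idI IH.
have [I1|properI] := pselect (I 1).
  exists [::]; split=> // Q /(_ _ I1).
  by rewrite /in_point idealr1.
have [primeI|] := pselect (forall f g, I (f * g) -> I f \/ I g).
  exists [:: prime_point idI properI primeI]; split=> [P|Q IQ].
    by rewrite inE => /eqP -> g Ig; rewrite in_prime_point; apply/asboolP.
  exists (prime_point idI properI primeI); first exact: mem_head.
  by move=> g; rewrite in_prime_point => /asboolP /IQ.
move=> /existsNP[u /existsNP[v /not_implyP[Iuv /not_orP[Iu Iv]]]].
have adj w : ~ I w -> exists s : seq (spec {mpoly k[n]}),
    (forall P, P \in s -> zero_locus I P) /\
    forall Q, zero_locus I Q -> w \in in_point Q ->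
      exists2 P, P \in s & {subset in_point P <= in_point Q}.
  move=> Iw; have [I0 IB IM] := idI.
  have sI : I `<=` [set f | exists a, I (f - a * w)].
    by move=> f If; exists 0; rewrite mul0r subr0.
  have [||s [s1 s2]] := IH [set f | exists a, I (f - a * w)].
  - exact: is_ideal_adjoin.
  - split=> // /(_ w) wI; apply/Iw/wI; exists 1.
    by rewrite mul1r subrr.
  exists s; split=> [P /s1 sP g /sI/sP //|Q IQ wQ]; apply: s2 => f [a] /IQ faQ.
  by rewrite -(subrK (a * w) f) /in_point rpredD // idealMr.
have [s [s1 s2]] := adj u Iu; have [t [t1 t2]] := adj v Iv.
exists (s ++ t); split=> [P|Q IQ].
  by rewrite mem_cat => /orP[/s1|/t1].
have := IQ _ Iuv; rewrite /in_point prime_idealrM => /orP[uQ|vQ].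
  by have [P Ps PQ] := s2 Q IQ uQ; exists P; rewrite // mem_cat Ps.
by have [P Pt PQ] := t2 Q IQ vQ; exists P; rewrite // mem_cat Pt orbT.
Qed.

(** * Images of points under rational maps *)

Lemma eq_mmap (k K : comNzRingType) (n : nat) (h h' : k -> K) (v v' : 'I_n -> K) :
  h =1 h' -> v =1 v' -> mmap h v =1 mmap h' v'.
Proof.
move=> hh' vv' p; apply: eq_bigr => m _.
by rewrite hh' (mmap1_eq _ vv').
Qed.

Lemma rmorph_mpolyE (k K : comNzRingType) (n : nat)
    (g : {rmorphism {mpoly k[n]} -> K}) (p : {mpoly k[n]}) :
  g p = mmap (g \o @mpolyC n k) (fun i => g 'X_i) p.
Proof.
rewrite [in LHS](mpolyE p) rmorph_sum; apply: eq_bigr => m _ /=.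
rewrite -mul_mpolyC rmorphM; congr (_ * _).
by rewrite mpolyXE_id rmorph_prod; apply: eq_bigr => i _; rewrite rmorphXn.
Qed.

(** The choice of [G] and [N] is independent of [K], so that values in different fields can be
    compared through the same polynomial. *)
Lemma clear_denominators (k : comNzRingType) (n m : nat)
    (p q : 'I_m -> {mpoly k[n]}) (g : {mpoly k[m]}) :
  exists (G : {mpoly k[n]}) (N : nat),
    forall (K : fieldType) (h : {rmorphism {mpoly k[n]} -> K}) (v : 'I_m -> K),
      (forall i, v i * h (q i) = h (p i)) ->
    mmap (h \o @mpolyC n k) v g * h (\prod_i q i) ^+ N = h G.
Proof.
elim/mpolyind: g => [|c l g _ _ [G [N IHg]]].
  by exists 0, 0%N => K h v _; rewrite raddf0 mul0r rmorph0.
(* Over the common denominator [D], the numerator of the coordinate [i] is [r i]; a monomial [l]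
   therefore costs [mdeg l] factors [D]. *)
pose D := \prod_i q i; pose r i := p i * \prod_(j | j != i) q j.
exists (c%:MP * \prod_i r i ^+ l i * D ^+ N + G * D ^+ mdeg l), (mdeg l + N)%N.
move=> K h v hv; rewrite mmapD mmapZ mmapX mulrDl exprD.
rewrite [in X in _ + X](mulrC (h _ ^+ mdeg l)) [in X in _ + X]mulrA (IHg K h v hv).
rewrite rmorphD !rmorphM !rmorphXn /=; congr (_ + _).
rewrite !mulrA; congr (_ * _); rewrite -mulrA; congr (_ * _).
rewrite mdegE -prodrXr /mmap1 -big_split [RHS]rmorph_prod /=.
apply: eq_bigr => i _; rewrite -exprMn rmorphXn; congr (_ ^+ _).
by rewrite (bigD1 i) //= rmorphM mulrA hv -rmorphM.
Qed.

Lemma in_kernel_point (R : comNzRingType) (K : fieldType)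
  (phi : {rmorphism R -> K}) g : (g \in in_point (kernel_point phi)) = (phi g == 0).
Proof. by []. Qed.

Section Points.
Variable R : comNzRingType.
Implicit Types (P Q : spec R) (s : seq (spec R)).

Lemma in_pointM P f g : (f * g \in in_point P) = (f \in in_point P) || (g \in in_point P).
Proof. exact: prime_idealrM. Qed.

Lemma notin_point_bigM P (I : finType) (F : I -> R) :
  (forall i, F i \notin in_point P) -> \prod_i F i \notin in_point P.
Proof.
move=> FP; elim/big_ind: _ => // [|f g fP gP]; first by rewrite /in_point idealr1.
by rewrite in_pointM negb_or fP.
Qed.

(** Each [Q] has an element outside [P]; the product of these lies in every [Q], and outside [P] by
    primality. *)
Lemma prime_avoidance P s :
    (forall Q, Q \in s -> ~ {subset in_point Q <= in_point P}) ->
  exists2 h, h \notin in_point P & forall Q, Q \in s -> h \in in_point Q.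
Proof.
elim: s => [_|Q s IHs QsP].
  by exists 1; rewrite // /in_point idealr1.
have [|h hP hs] := IHs; first by move=> Q' Q's; apply: QsP; rewrite inE Q's orbT.
have /existsNP[f /not_implyP[fQ /negP fP]] := QsP Q (mem_head _ _).
exists (f * h) => [|Q']; first by rewrite in_pointM negb_or fP.
rewrite inE in_pointM => /orP[/eqP ->|/hs ->]; last by rewrite orbT.
by rewrite fQ.
Qed.

Lemma ex_minimal_point s P0 : P0 \in s -> exists2 P, P \in s &
  forall Q, Q \in s -> {subset in_point Q <= in_point P} ->
    {subset in_point P <= in_point Q}.
Proof.
elim: s P0 => // P1 s IHs P0 _.
case: s => [|P2 s] in IHs *.
  by exists P1; [exact: mem_head | move=> Q; rewrite inE => /eqP ->].
have [P Ps minP] := IHs _ (mem_head P2 s).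
have [P1P|nP1P] := pselect {subset in_point P1 <= in_point P}.
  exists P1; first exact: mem_head.
  move=> Q; rewrite inE => /orP[/eqP -> //|Qs] QP1 f /P1P.
  by apply: minP => // g /QP1/P1P.
exists P => [|Q]; first by rewrite inE Ps orbT.
by rewrite inE => /orP[/eqP ->|/minP].
Qed.

End Points.

Section Image.
Variables (k : fieldType) (n m : nat) (X : set (affine_space k n)).
Variable f : 'I_m -> ratfun X.

Lemma set_type_vanishing (x : X) g :
  vanishing_ideal X g -> g \in in_point (\val x).
Proof. by apply; apply: set_valP. Qed.

(** Two fractions equal to [r] are equal to each other, because the regular denominator of [r] can
    be cancelled from the cross-multiplied identity. *)
Lemma ratfun_value_uniq (r : ratfun X) (x : X) (c c' : residue_field (\val x)) :
  ratfun_value r c -> ratfun_value r c' -> c = c'.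
Proof.
move=> [s [rs ds ->]] [s' [rs' ds' ->]].
have ss' : vanishing_ideal X (num s * den s' - num s' * den s).
  apply: (@den_regular _ _ _ r) => P XP.
  have -> : (num s * den s' - num s' * den s) * den r =
      (num r * den s' - num s' * den r) * den s
      - (num r * den s - num s * den r) * den s'.
    rewrite !mulrBl opprB [num r * den s' * den s]mulrAC [RHS]addrC addrA subrK.
    by rewrite (mulrAC (num s)) (mulrAC (num s')).
  by rewrite /in_point rpredB // mulrC idealMr //; [exact: rs' | exact: rs].
have {ds ds'} [ds ds'] : residue (\val x) (den s) != 0 /\
    residue (\val x) (den s') != 0 by rewrite !residue_eq0.
apply/eqP; rewrite eqr_div // -subr_eq0 -!rmorphM -rmorphB residue_eq0.
exact: set_type_vanishing.
Qed.

Lemma coords_image_uniq (x : X) Q Q' :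
  coords_image f x Q -> coords_image f x Q' -> Q = Q'.
Proof.
move=> [v fv ->] [v' fv' ->]; congr (point_of_coords _ _).
by apply/funext => i; apply: ratfun_value_uniq (fv i) (fv' i).
Qed.

Definition frac_point (s : 'I_m -> ratfun X) (x : X) : affine_space k m :=
  point_of_coords (scalar_residue (\val x))
    (fun i => residue (\val x) (num (s i)) / residue (\val x) (den (s i))).

Lemma coords_image_frac (x : X) Q : coords_image f x Q ->
  exists2 s : 'I_m -> ratfun X,
    forall i, ratfun_eq (f i) (s i) /\ den (s i) \notin in_point (\val x) &
    Q = frac_point s x.
Proof.
move=> [v /choice[s fs] ->]; exists s => [i|]; first by have [] := fs i.
by congr (point_of_coords _ _); apply/funext => i; have [] := fs i.
Qed.

Lemma coords_imageI (x : X) (s : 'I_m -> ratfun X) :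
    (forall i, ratfun_eq (f i) (s i) /\ den (s i) \notin in_point (\val x)) ->
  coords_image f x (frac_point s x).
Proof.
move=> fs; exists (fun i =>
  residue (\val x) (num (s i)) / residue (\val x) (den (s i))) => //.
by move=> i; exists (s i); have [] := fs i.
Qed.

(** The pullback of [g] along the fractions [s] is [G] over a power of the product of the
    denominators. The second clause is the same fact for arbitrary field-valued points. *)
Lemma in_image_point (s : 'I_m -> ratfun X) (g : {mpoly k[m]}) :
  exists G : {mpoly k[n]},
    (forall x : X, (forall i, den (s i) \notin in_point (\val x)) ->
      (g \in in_point (frac_point s x)) = (G \in in_point (\val x))) /\
    forall (K : fieldType) (h : {rmorphism {mpoly k[n]} -> K}) (v : 'I_m -> K),
      (forall i, h (den (s i)) != 0) ->
      (forall i, v i * h (den (s i)) = h (num (s i))) ->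
      (mmap (h \o @mpolyC n k) v g == 0) = (h G == 0).
Proof.
have [G [N GE]] := clear_denominators (fun i => num (s i)) (fun i => den (s i)) g.
have GE' (K : fieldType) (h : {rmorphism {mpoly k[n]} -> K}) (v : 'I_m -> K) :
    (forall i, h (den (s i)) != 0) ->
    (forall i, v i * h (den (s i)) = h (num (s i))) ->
    (mmap (h \o @mpolyC n k) v g == 0) = (h G == 0).
  move=> d0 hv; rewrite -(GE K h v hv) mulf_eq0 expf_eq0 rmorph_prod.
  have /negPf -> : \prod_i h (den (s i)) != 0 by apply/prodf_neq0.
  by rewrite andbF orbF.
exists G; split=> // x dx.
have d0 i : residue (\val x) (den (s i)) != 0 by rewrite residue_eq0.
rewrite -[RHS]residue_eq0.
exact: (@GE' (residue_field (\val x)) (residue (\val x)) _ d0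
  (fun i => divfK (d0 i) _)).
Qed.

(** Denominators nonzero at [x] are nonzero at its generization [x0], so the same fractions compute
    both images, and the same [G] tests membership in both. *)
Lemma coords_image_generization (x0 x : X) Q :
    {subset in_point (\val x0) <= in_point (\val x)} -> coords_image f x Q ->
  exists2 Q0, coords_image f x0 Q0 & {subset in_point Q0 <= in_point Q}.
Proof.
move=> x0x /coords_image_frac[s fs ->].
have dx i := proj2 (fs i).
have dx0 i : den (s i) \notin in_point (\val x0).
  by apply: contra (dx i); apply: x0x.
exists (frac_point s x0).
  by apply: coords_imageI => i; split=> //; case: (fs i).
move=> g g0; have [G [GE _]] := in_image_point s g.
apply: (etrans (GE x dx)); apply: x0x.
exact: etrans (esym (GE x0 dx0)) g0.
Qed.

End Image.

(** * Open subsets of the image *)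

Section OpenImage.
Variables (k : fieldType) (n m : nat) (X : set (affine_space k n)).
Variable f : 'I_m -> ratfun X.

(** The [m] target variables come first, while [extend_point] writes the total as [n + m]; hence the
    casts. *)
Let y_ord (i : 'I_m) : 'I_(n + m) := cast_ord (addnC m n) (lshift n i).
Let x_ord (i : 'I_n) : 'I_(n + m) := cast_ord (addnC m n) (rshift m i).
Let shift (p : {mpoly k[n]}) : {mpoly k[n + m]} :=
  mmap (@mpolyC (n + m) k) (fun i => 'X_(x_ord i)) p.

Lemma mmap_shift (K : fieldType) (h : {rmorphism k -> K}) (w : nat -> K)
    (p : {mpoly k[n]}) :
  mmap h (fun i : 'I_(n + m) => w i) (shift p) =
  mmap h (fun i : 'I_n => w (m + i)%N) p.
Proof.
pose e := mmap h (fun i : 'I_(n + m) => w i) : {rmorphism _ -> _}.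
pose s := mmap (@mpolyC (n + m) k) (fun i : 'I_n => 'X_(x_ord i)) : {rmorphism _ -> _}.
rewrite -[LHS]/((e \o s) p) rmorph_mpolyE; apply: eq_mmap => [c|i] /=.
  by rewrite /e /s /= !mmapC.
by rewrite /e /s /= !mmapX !mmap1U mmapX mmap1U.
Qed.

Lemma image_contains_open (x : X) Q : coords_image f x Q ->
  exists2 g, g \notin in_point Q & forall Q' : affine_space k m,
    {subset in_point Q <= in_point Q'} -> g \notin in_point Q' ->
    exists2 P' : affine_space k n, {subset in_point (\val x) <= in_point P'} &
      forall x' : X, \val x' = P' -> coords_image f x' Q'.
Proof.
move=> /coords_image_frac[s fs eQ].
have dx i := proj2 (fs i).
pose P := \val x; pose h := scalar_residue P.
pose v (i : 'I_m) := residue P (num (s i)) / residue P (den (s i)).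
have vE i : v i * residue P (den (s i)) = residue P (num (s i)).
  by rewrite /v divfK // residue_eq0.
(* The variables of index below m are the coordinates of the target, the
   remaining ones those of the source. *)
pose z (i : nat) := if insub i is Some l then v l else
  if insub (i - m)%N is Some l then residue P 'X_l else 0.
have z_y (i : 'I_m) : z i = v i by rewrite /z valK.
have z_x (i : 'I_n) : z (m + i)%N = residue P 'X_i.
  by rewrite /z insubN ?addKn ?valK // -leqNgt leq_addr.
have evQ g : (g \in in_point Q) = (mmap h (fun i : 'I_m => z i) g == 0).
  rewrite eQ -[LHS]/(mmap h v g == 0).
  by rewrite (@eq_mmap _ _ _ h h v (fun i : 'I_m => z i)) // => i; rewrite z_y.
have evP p : mmap h (fun i : 'I_(n + m) => z i) (shift p) = residue P p.
  rewrite mmap_shift [RHS]rmorph_mpolyE; apply: eq_mmap => [//|i].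
  exact: z_x.
pose D := \prod_i den (s i).
(* Keeping [D] nonzero ensures that the fractions [s] remain defined at the specialization to be
   found. *)
have [|g g0 ext] := @extend_point k _ h z m n (shift D).
  by rewrite evP residue_eq0 notin_point_bigM.
exists g => [|Q' QQ' gQ']; first by rewrite evQ.
pose w (i : nat) := if insub i is Some l then residue Q' ('X_l : {mpoly k[m]}) else 0.
have w_y (i : 'I_m) : w i = residue Q' 'X_i by rewrite /w valK.
have evw p : mmap (scalar_residue Q') (fun i : 'I_m => w i) p = residue Q' p.
  by rewrite [RHS]rmorph_mpolyE; apply: eq_mmap => [//|i]; exact: w_y.
have [||K [iota [w' [w'w sp nzD]]]] := ext _ (scalar_residue Q') w.
- by move=> p /eqP p0; apply/eqP; rewrite evw residue_eq0 QQ' // evQ.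
- by rewrite evw residue_eq0.
pose h' : {rmorphism k -> K} := iota \o scalar_residue Q'.
(* The last [n] coordinates of the extended point give a [K]-valued point of the source; its kernel
   is the specialization of [x]. *)
pose a : {rmorphism {mpoly k[n]} -> K} :=
  mmap h' (fun i : 'I_n => w' (m + i)%N).
have ev_shift p : mmap h' (fun i : 'I_(n + m) => w' i) (shift p) = a p.
  exact: mmap_shift.
have aP p : p \in in_point P -> a p = 0.
  by rewrite -residue_eq0 -evP => /eqP p0; rewrite -ev_shift sp.
have aD : a D != 0 by rewrite -ev_shift.
have ad i : a (den (s i)) != 0.
  by move: aD; rewrite /D rmorph_prod => /prodf_neq0; apply.
have w'E (i : 'I_m) : w' i * a (den (s i)) = a (num (s i)).
  apply/eqP; rewrite -!ev_shift -subr_eq0.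
  (* This equation of the graph of the map vanishes at [z], hence at [w']. *)
  pose r : {mpoly k[n + m]} := 'X_(y_ord i) * shift (den (s i)) - shift (num (s i)).
  have rE (M : fieldType) (j : {rmorphism k -> M}) (u : nat -> M) :
      mmap j (fun l : 'I_(n + m) => u l) r =
      u i * mmap j (fun l : 'I_(n + m) => u l) (shift (den (s i)))
      - mmap j (fun l : 'I_(n + m) => u l) (shift (num (s i))).
    by rewrite /r mmapB rmorphM /= mmapX mmap1U.
  by rewrite -rE sp // rE !evP z_y vE subrr.
exists (kernel_point a) => [p /aP|x' ex'].
  by rewrite in_kernel_point => ->.
have dx' i : den (s i) \notin in_point (\val x') by rewrite ex' in_kernel_point.
suff -> : Q' = frac_point s x'.
  by apply: coords_imageI => i; split=> //; case: (fs i).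
(* Both memberships say that [p] vanishes at the first [m] coordinates of [w']: for [Q'] since
   [iota] is injective, for the image through [G]. *)
apply: spec_ext => p; have [G [GE GE']] := in_image_point s p.
rewrite (GE x' dx') ex' in_kernel_point -(GE' K a (fun i => w' i) ad w'E).
rewrite -residue_eq0 -evw -(fmorph_eq0 iota).
pose b := mmap (scalar_residue Q') (fun i : 'I_m => w i) : {rmorphism _ -> _}.
rewrite -[iota _]/((iota \o b) p) rmorph_mpolyE; congr (_ == 0).
apply: eq_mmap => [c|i] /=; first by rewrite /b /a /= !mmapC.
by rewrite /b /= mmapX mmap1U w'w.
Qed.

End OpenImage.

(** * Closed sets and closures in subspaces of affine space *)

Section Subspace.
Variables (k : fieldType) (n : nat) (X : set (affine_space k n)).

Lemma closed_preimage_val (Z : set (affine_space k n)) :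
  closed Z -> closed (\val @^-1` Z : set X).
Proof.
move=> cZ; rewrite -openC; exists (~` Z) => //.
by rewrite openC.
Qed.

Lemma closed_image_val (C : set X) :
  closed X -> closed C -> closed [set \val x | x in C].
Proof.
move=> cX; rewrite -openC => -[U oU UC].
suff -> : [set \val x | x in C] = X `&` ~` U.
  by apply: closedI => //; rewrite closedC.
rewrite predeqE => P; split=> [[x Cx <-]|[XP UP]].
  split; first exact: set_valP.
  by move=> Ux; have : (~` C) x by rewrite -UC.
exists (SigSub (mem_set XP)) => //.
apply: contrapT => nC.
by have : (\val @^-1` U) (SigSub (mem_set XP) : X) by rewrite UC.
Qed.

Lemma zero_locus_vanishing (Z : set (affine_space k n)) :
  closed Z -> zero_locus (vanishing_ideal Z) = Z.
Proof.
move=> /zariski_closedE[S ->]; rewrite predeqE => P; split=> [h g Sg|ZP g hg].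
  by apply: h => P' /(_ g Sg).
exact: hg.
Qed.

Lemma is_ideal_vanishing (Z : set (affine_space k n)) :
  is_ideal (vanishing_ideal Z).
Proof.
split=> [P _|f g fZ gZ P ZP|a f fZ P ZP]; rewrite /in_point.
- exact: rpred0.
- by rewrite rpredB; [| exact: fZ | exact: gZ].
- by rewrite idealMr //; exact: fZ.
Qed.

End Subspace.

(** The specializations of finitely many points form a closed set, the zero locus of the
    intersection [S] of their primes. *)
Lemma closure_common_zeros (k : fieldType) (m : nat) (Y : set (affine_space k m))
    (A : set Y) (t : seq (affine_space k m)) :
    (forall y, A y -> exists2 Q, Q \in t & {subset in_point Q <= in_point (\val y)}) ->
  forall y, closure A y ->
    exists2 Q, Q \in t & {subset in_point Q <= in_point (\val y)}.
Proof.
move=> At y cAy; apply: contrapT => nt.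
pose S := [set h : {mpoly k[m]} | forall Q, Q \in t -> h \in in_point Q].
have [|h hy hS] := @prime_avoidance _ (\val y : spec _) t.
  by move=> Q Qt Qy; apply: nt; exists Q.
have : (\val @^-1` zero_locus S) y.
  apply: (@closed_preimage_val k m Y (zero_locus S)).
    by apply/zariski_closedE; exists S.
  apply: closureS cAy => y' /At[Q Qt Qy'] g Sg.
  exact/Qy'/Sg.
by move=> /(_ h hS) hy'; move: hy; rewrite hy'.
Qed.

(** * The relative boundary hull of the image *)

Theorem theorem1p1 (k : fieldType) (n m : nat)
    (X : set (affine_space k n)) (Y : set (affine_space k m))
    (hX : closed X) (hY : closed Y) (f : rational_map X Y)
    (C : set X) (hC : closed C) :
  exists D : set Y, relative_boundary_hull (image_of f C) D.
Proof.
set A := image_of f C.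
have [[y0 Ay0]|A0] := pselect (A !=set0); last first.
  by exists set0; split.
pose Z : set (affine_space k n) := [set \val x | x in C].
have ZE : zero_locus (vanishing_ideal Z) = Z.
  exact/zero_locus_vanishing/closed_image_val.
have upZ (P P' : affine_space k n) :
    Z P -> {subset in_point P <= in_point P'} -> Z P'.
  by rewrite -ZE => ZP PP' g /ZP /PP'.
have [s [sZ Zs]] := finite_generic_points (is_ideal_vanishing Z).
rewrite ZE in sZ Zs.
pose img (P : affine_space k n) (Q : affine_space k m) :=
  exists x : X, [/\ \val x = P, C x & coords_image (coords f) x Q].
(* Where there is no image, [im] takes the default value [\val y0]; the filter in [t] discards these
   points. *)
have /choice[im imP] (P : affine_space k n) :
    exists Q', (exists Q, img P Q) -> img P Q'.
  have [[Q PQ]|nP] := pselect (exists Q, img P Q); first by exists Q.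
  by exists (\val y0) => /nP.
pose t := [seq im P | P <- s & `[< exists Q, img P Q >]].
have tA Q : Q \in t -> exists2 x : X, C x & coords_image (coords f) x Q.
  move=> /mapP[P]; rewrite mem_filter => /andP[/asboolP /imP[x [_ Cx xQ]] _] ->.
  by exists x.
have At (y : Y) : A y ->
    exists2 Q, Q \in t & {subset in_point Q <= in_point (\val y)}.
  move=> [x Cx xy].
  have [|P Ps Px] := Zs (\val x); first by exists x.
  have [x0 Cx0 ex0] := sZ P Ps; subst P.
  have [Q0 x0Q0 Q0y] := coords_image_generization Px xy.
  have ex : exists Q, img (\val x0) Q by exists Q0, x0.
  exists Q0 => //; apply/mapP; exists (\val x0).
    by rewrite mem_filter Ps andbT; apply/asboolP.
  have [x1 [/val_inj ex1 _ x1Q]] := imP _ ex; subst x1.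
  exact: coords_image_uniq x0Q0 x1Q.
have [Q1 Q1t _] := At _ Ay0.
have [Q Qt minQ] := ex_minimal_point Q1t.
have [x Cx xQ] := tA Q Qt.
have [|g1 g1Q g1t] := @prime_avoidance _ (Q : spec _)
  [seq Q' <- t | `[< ~ {subset in_point Q' <= in_point Q} >]].
  by move=> Q'; rewrite mem_filter => /andP[/asboolP].
have [g2 g2Q open_g2] := image_contains_open xQ.
pose g := g1 * g2.
(* Some [Q'] in [t] lies below [y]. As [g1] is not in [y], this [Q'] is contained in [Q], so it
   equals [Q] by minimality, and [open_g2] applies to [y]. *)
have in_A (y : Y) : closure A y -> g \notin in_point (\val y) -> A y.
  move=> cAy; rewrite in_pointM negb_or => /andP[g1y g2y].
  have [Q' Q't Q'y] := closure_common_zeros At cAy.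
  have Q'Q : {subset in_point Q' <= in_point Q}.
    apply: contrapT => nQ'Q; move/negP: g1y; apply; apply/Q'y/g1t.
    by rewrite mem_filter Q't andbT; apply/asboolP.
  have QQ' := minQ Q' Q't Q'Q.
  have [|P' xP' imP'] := open_g2 (\val y) _ g2y; first by move=> h /QQ'/Q'y.
  have Zx : Z (\val x) by exists x.
  have [x' Cx' ex'] : Z P' := upZ _ _ Zx xP'.
  exists x'; first exact: Cx'.
  exact: imP' ex'.
exists (closure A `&` \val @^-1` zero_locus [set g]); split.
  by move=> A0; have : (set0 : set Y) y0 by rewrite -A0.
move=> _; split.
- apply: closedI; first exact: closed_closure.
  by apply: closed_preimage_val; apply/zariski_closedE; exists [set g].
- move=> y [cAy nAy]; split=> // h ->; apply: contrapT => /negP gy.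
  exact/nAy/in_A.
(* The inclusion is proper because [Q] itself is in [A], and the prime [Q] contains neither [g1] nor
   [g2]. *)
- split; first by move=> y [].
  have YQ : Y Q := coords_into xQ.
  move=> /(_ (SigSub (mem_set YQ) : Y)) [|_ /(_ g erefl)].
    by apply: subset_closure; exists x.
  by rewrite in_pointM (negPf g1Q) (negPf g2Q).
Qed.
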